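(* Let $n,m\geq1$ and let $X$ be an infinite countable set. Let $c\in\mathbb{F}_{n+1}$ and $d\in\mathbb{F}_{m+1}$ be cyclically reduced non-primitive words (with respect to fixed free bases) such that the exponent sum of some generator occurring in $c$ is zero, and the exponent sum of some generator occurring in $d$ is zero. Then: (1) there exists a transitive, faithful and amenable action of the amalgamated free product $\mathbb{F}_{n+1}\ast_{\langle c=d\rangle}\mathbb{F}_{m+1}$ on $X$; (2) every finite index subgroup of $\mathbb{F}_{n+1}\ast_{\langle c=d\rangle}\mathbb{F}_{m+1}$ admits a transitive, faithful and amenable action on $X$.
   Context: An action of a countable group $\Gamma$ on $X$ is amenable if there is a sequence $(A_k)$ of finite non-empty subsets of $X$ with $|A_k\triangle gA_k|/|A_k|\to0$ for every $g\in\Gamma$. A word in a free group is non-primitive if it is not part of any free basis. $\mathbb{F}_{n+1}\ast_{\langle c=d\rangle}\mathbb{F}_{m+1}$ is the amalgamated free product identifying $\langle c\rangle$ with $\langle d\rangle$ via $c\mapsto d$. *)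

(* Defs.v *)
From HB Require Import structures.
From mathcomp Require Import all_boot all_order all_algebra.
From mathcomp Require Import finmap.
From Stdlib Require Import Relations.
Set Implicit Arguments. Unset Strict Implicit. Unset Printing Implicit Defensive.
Import GRing.Theory Num.Theory.

(* Words over an alphabet of generators I: letters are (i, false) = i  *)
(* and (i, true) = i^-1.                                                *)
Definition word (I : Type) := seq (I * bool).

Definition linv {I : Type} (l : I * bool) : I * bool := (l.1, ~~ l.2).
Definition winv {I : Type} (w : word I) : word I := rev (map linv w).

Definition reduced {I : eqType} (w : word I) : bool :=
  sorted (fun a b => b != linv a) w.

Definition cyc_reduced {I : eqType} (w : word I) : bool :=
  reduced w && (if w is l :: _ then last l w != linv l else true).

Definition occurs {I : eqType} (i : I) (w : word I) : bool :=
  has (fun l => l.1 == i) w.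

Definition expsum {I : eqType} (i : I) (w : word I) : int :=
  \sum_(l <- w | l.1 == i) (if l.2 then (-1)%R else 1%R).

(* Group presentations <I | relations> as rewriting on words.          *)
Definition step {I : Type} (R : word I -> word I -> Prop) (u v : word I) : Prop :=
  exists a b x y, R x y /\ u = a ++ x ++ b /\ v = a ++ y ++ b.

Definition geq {I : Type} (R : word I -> word I -> Prop) : word I -> word I -> Prop :=
  clos_refl_sym_trans (word I) (step R).

Inductive cancel_rel {I : Type} : word I -> word I -> Prop :=
  CancelRel (l : I * bool) : cancel_rel [:: l; linv l] [::].

Definition free_eq {I : Type} : word I -> word I -> Prop := geq (@cancel_rel I).

Definition wsubst {I J : Type} (b : I -> word J) (w : word I) : word J :=
  flatten (map (fun l => if l.2 then winv (b l.1) else b l.1) w).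

(* c is primitive in F(I): c belongs to a free basis, i.e. to a family
   b : I -> F(I) such that the induced homomorphism F(I) -> F(I) is an
   isomorphism (bijective). *)
Definition primitive {I : Type} (c : word I) : Prop :=
  exists b : I -> word I,
    (exists j, free_eq (b j) c) /\
    (forall w, exists v, free_eq (wsubst b v) w) /\
    (forall v v', free_eq (wsubst b v) (wsubst b v') -> free_eq v v').

Definition emb_l {A B : Type} (w : word A) : word (A + B) :=
  map (fun l => (inl l.1, l.2)) w.
Definition emb_r {A B : Type} (w : word B) : word (A + B) :=
  map (fun l => (inr l.1, l.2)) w.

Definition amalg_rel {A B : Type} (c : word A) (d : word B)
    (x y : word (A + B)) : Prop :=
  cancel_rel x y \/ (x = emb_l c /\ y = emb_r d).

Definition amalg_eq {A B : Type} (c : word A) (d : word B) :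
  word (A + B) -> word (A + B) -> Prop := geq (amalg_rel c d).

(* Subgroups of a presented group G = words / eqG, given as predicates *)
(* on words that are unions of eqG-classes.                             *)
Definition subgroup {I : Type} (eqG : word I -> word I -> Prop)
    (P : word I -> Prop) : Prop :=
  [/\ forall u v, eqG u v -> P u -> P v,
      P [::],
      forall u v, P u -> P v -> P (u ++ v)
    & forall u, P u -> P (winv u)].

Definition finite_index {I : eqType} (eqG : word I -> word I -> Prop)
    (P : word I -> Prop) : Prop :=
  exists ts : seq (word I),
    forall w, exists2 t, t \in ts & exists2 h, P h & eqG w (t ++ h).

Definition is_action {I : Type} (eqG : word I -> word I -> Prop)
    (P : word I -> Prop) (X : Type) (rho : word I -> X -> X) : Prop :=
  [/\ forall x, rho [::] x = x,
      forall u v, P u -> P v -> forall x, rho (u ++ v) x = rho u (rho v x)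
    & forall u v, P u -> eqG u v -> forall x, rho u x = rho v x].

Definition faithful_action {I : Type} (eqG : word I -> word I -> Prop)
    (P : word I -> Prop) (X : Type) (rho : word I -> X -> X) : Prop :=
  forall u, P u -> (forall x, rho u x = x) -> eqG u [::].

Definition transitive_action {I : Type} (P : word I -> Prop) (X : Type)
    (rho : word I -> X -> X) : Prop :=
  forall x y : X, exists2 g, P g & rho g x = y.

Local Open Scope fset_scope.

(* amenable: a Følner sequence of finite nonempty subsets A_k with
   |A_k Δ g A_k| / |A_k| -> 0 for every g in H  (written: for every N > 0,
   eventually N * |A_k Δ g A_k| < |A_k|). *)
Definition amenable_action {I : Type} (P : word I -> Prop) (X : choiceType)
    (rho : word I -> X -> X) : Prop :=
  exists A : nat -> {fset X},
    (forall k, A k != fset0) /\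
    forall g, P g -> forall N : nat, (0 < N)%N ->
      exists K : nat, forall k : nat, (K <= k)%N ->
        (N * #|` ((A k `\` [fset rho g x | x in A k])
                  `|` ([fset rho g x | x in A k] `\` A k))| < #|` A k|)%N.

Definition good_action {I : Type} (eqG : word I -> word I -> Prop)
    (P : word I -> Prop) (X : choiceType) : Prop :=
  exists rho : word I -> X -> X,
    [/\ is_action eqG P rho, transitive_action P rho,
        faithful_action eqG P rho & amenable_action P rho].

(* Main.v *)
Require Import Defs.
From HB Require Import structures.
From mathcomp Require Import all_boot all_order all_algebra.
From mathcomp Require Import finmap.
From mathcomp Require Import boolp classical_sets functions cardinality.
From mathcomp Require Import zify.
From Stdlib Require Import Relations RelationClasses Morphisms.

(* Let G be the amalgam, C its subgroup generated by c = d, and t, s the generators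
   of exponent sum zero in c and d. On the G-set Z (t and s shift, the other
   generators act trivially) and on the base point of G/C the element c acts
   trivially, so conjugating the action of the second factor on the disjoint union
   of Z and G/C by the transposition of -1 and C yields a new G-action. A subgroup
   H of finite index acts transitively on the H-orbit of 0. This orbit contains a
   multiple ray of the nonnegative integers, where long intervals are Folner sets.
   The words t^K s^-1 lead from 0 to the coset t^K C, around which, for K large,
   G acts by left multiplication. Hence an element of H acting trivially on the
   orbit makes c^k t^M = t^M c^k' with M large for some k, k'. As the first factor
   embeds in G and the axis of c in the Cayley tree has bounded height with respect
   to the exponent of t, this forces k' = 0, and the element is trivial. *)

Set Implicit Arguments.
Unset Strict Implicit.
Unset Printing Implicit Defensive.

Import GRing.Theory Num.Theory.

(** * Words modulo the congruence generated by a relation *)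

Local Notation weq := Defs.geq.

(** The condition under which words modulo [weq R] form a group, with inverse [winv]. *)
Definition extends_cancel {I : Type} (R : word I -> word I -> Prop) : Prop :=
  forall x y, cancel_rel x y -> R x y.

#[local] Instance weq_equiv (I : Type) (R : word I -> word I -> Prop) :
  Equivalence (weq R).
Proof.
split; first by move=> u; exact: rst_refl.
  by move=> u v; exact: rst_sym.
by move=> u v w; exact: rst_trans.
Qed.

Lemma weq_ctx (I : Type) (R : word I -> word I -> Prop) (a b u v : word I) :
  weq R u v -> weq R (a ++ u ++ b) (a ++ v ++ b).
Proof.
elim=> {u v} [u v [p [q [x [y [Rxy [-> ->]]]]]]|u|u v _ IH|u v w _ IHu _ IHv].
- apply: rst_step; exists (a ++ p), (q ++ b), x, y.
  by rewrite -!catA.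
- exact: rst_refl.
- exact: rst_sym.
- exact: rst_trans IHu IHv.
Qed.

#[local] Instance weq_cat (I : Type) (R : word I -> word I -> Prop) :
  Proper (weq R ==> weq R ==> weq R) cat.
Proof.
move=> u u' Hu v v' Hv; transitivity (u' ++ v).
  by have := weq_ctx [::] v Hu; rewrite !cat0s.
by have := weq_ctx u' [::] Hv; rewrite !cats0.
Qed.

Lemma weq_rel (I : Type) (R : word I -> word I -> Prop) u v :
  R u v -> weq R u v.
Proof.
by move=> Ruv; apply: rst_step; exists [::], [::], u, v; rewrite /= !cats0.
Qed.

Lemma linvK (I : Type) : involutive (@linv I).
Proof. by case=> i b; rewrite /linv /= negbK. Qed.

Lemma winvK (I : Type) : involutive (@winv I).
Proof.
by move=> w; rewrite /winv map_rev revK mapK //; exact: linvK.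
Qed.

Lemma winv_cat (I : Type) (u v : word I) : winv (u ++ v) = winv v ++ winv u.
Proof. by rewrite /winv map_cat rev_cat. Qed.

Lemma size_winv (I : Type) (w : word I) : size (winv w) = size w.
Proof. by rewrite size_rev size_map. Qed.

Lemma weq_catV (I : Type) (R : word I -> word I -> Prop) (w : word I) :
  extends_cancel R -> weq R (w ++ winv w) [::].
Proof.
move=> hR; elim: w => [|l w IH]; first exact: rst_refl.
rewrite -cat1s winv_cat -catA (catA w) IH.
exact/weq_rel/hR.
Qed.

Lemma weq_Vcat (I : Type) (R : word I -> word I -> Prop) (w : word I) :
  extends_cancel R -> weq R (winv w ++ w) [::].
Proof. by move=> hR; rewrite -{2}(winvK w); exact: weq_catV. Qed.

Lemma weq_cancel_l (I : Type) (R : word I -> word I -> Prop) (x u v : word I) :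
  extends_cancel R -> weq R (x ++ u) (x ++ v) -> weq R u v.
Proof.
move=> hR E; rewrite -[u]cat0s -[v]cat0s -(weq_Vcat x hR) -!catA E.
exact: rst_refl.
Qed.

Lemma weq_cancel_r (I : Type) (R : word I -> word I -> Prop) (x u v : word I) :
  extends_cancel R -> weq R (u ++ x) (v ++ x) -> weq R u v.
Proof.
move=> hR E; rewrite -[u]cats0 -[v]cats0 -(weq_catV x hR) !catA E.
exact: rst_refl.
Qed.

(** * Powers of a word *)

Definition wexp {I : Type} (w : word I) (n : nat) : word I := flatten (nseq n w).

Definition wpow {I : Type} (w : word I) (k : int) : word I :=
  match k with Posz n => wexp w n | Negz n => wexp (winv w) n.+1 end.

Lemma wexpD (I : Type) (w : word I) a b : wexp w (a + b) = wexp w a ++ wexp w b.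
Proof. by rewrite /wexp nseqD flatten_cat. Qed.

Lemma wexpS (I : Type) (w : word I) a : wexp w a.+1 = w ++ wexp w a.
Proof. by []. Qed.

Lemma wexpSr (I : Type) (w : word I) a : wexp w a.+1 = wexp w a ++ w.
Proof. by rewrite -addn1 wexpD /wexp /= cats0. Qed.

Lemma wexpM (I : Type) (w : word I) a b : wexp (wexp w a) b = wexp w (a * b).
Proof.
by elim: b => [|b IH]; [rewrite muln0 | rewrite wexpS IH mulnS wexpD].
Qed.

Lemma size_wexp (I : Type) (w : word I) n : size (wexp w n) = n * size w.
Proof. by elim: n => // n IH; rewrite wexpS size_cat IH mulSn. Qed.

Lemma wpowN (I : Type) (w : word I) (k : int) : wpow w (- k)%R = wpow (winv w) k.
Proof. by case: k => [[|n]|n] //; rewrite NegzE opprK /= winvK. Qed.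

Lemma wpow_succ (I : Type) (R : word I -> word I -> Prop) (w : word I) (k : int) :
  extends_cancel R -> weq R (wpow w (1 + k)%R) (w ++ wpow w k).
Proof.
move=> hR; case: k => n; first exact: rst_refl.
have -> : (1 + Negz n)%R = (- (n%:Z))%R by lia.
rewrite wpowN /= wexpS catA weq_catV //; exact: rst_refl.
Qed.

Lemma wpowD (I : Type) (R : word I -> word I -> Prop) (w : word I) (a b : int) :
  extends_cancel R -> weq R (wpow w (a + b)%R) (wpow w a ++ wpow w b).
Proof.
move=> hR.
have pos v n k : weq R (wpow v (n%:Z + k)%R) (wexp v n ++ wpow v k).
  elim: n => [|n IH]; first by rewrite add0r; exact: rst_refl.
  have -> : (n.+1%:Z + k = 1 + (n%:Z + k))%R by lia.
  by rewrite wpow_succ // IH wexpS catA; exact: rst_refl.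
case: a => n; first exact: pos.
(* A negative first exponent becomes positive on replacing [w] by its inverse and negating both
   exponents. *)
rewrite -(opprK (Negz n + b)%R) opprD wpowN NegzE opprK pos.
by rewrite -wpowN opprK; exact: rst_refl.
Qed.

Lemma wpow_emb_l (A B : Type) (w : word A) (k : int) :
  wpow (@emb_l A B w) k = emb_l (wpow w k).
Proof.
have E n v : wexp (@emb_l A B v) n = emb_l (wexp v n).
  by elim: n => // n IH; rewrite !wexpS IH /emb_l map_cat.
case: k => n; rewrite /wpow -E //; congr wexp.
by rewrite /winv /emb_l map_rev -!map_comp.
Qed.

(** * Letterwise actions and their gluing over an amalgam *)

Definition wact {I Y : Type} (f : I * bool -> Y -> Y) (w : word I) (y : Y) : Y :=
  foldr f y w.

Lemma wact_cat (I Y : Type) (f : I * bool -> Y -> Y) u v y :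
  wact f (u ++ v) y = wact f u (wact f v y).
Proof. exact: foldr_cat. Qed.

Lemma wact_weq (I Y : Type) (R : word I -> word I -> Prop)
    (f : I * bool -> Y -> Y) (u v : word I) :
  (forall x y, R x y -> wact f x =1 wact f y) ->
  weq R u v -> wact f u =1 wact f v.
Proof.
move=> hf; elim=> {u v} [u v [p [q [x [y [Rxy [-> ->]]]]]]|u|u v _ IH|u v w _ IHu _ IHv] z //.
- by rewrite !wact_cat (hf _ _ Rxy).
- by rewrite IHu IHv.
Qed.

Lemma wact_free_eq (I Y : Type) (f : I * bool -> Y -> Y) (u v : word I) :
  (forall l, cancel (f (linv l)) (f l)) -> free_eq u v -> wact f u =1 wact f v.
Proof. by move=> fK; apply: wact_weq => _ _ [l] z /=; exact: fK. Qed.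

(** Glues actions [f] and [g] of two free groups to one of their free product, the second conjugated
    by the involution [tau]. It descends to the amalgam once [c] and the conjugated [d] act
    alike. *)
Definition twist {A B Y : Type} (f : A * bool -> Y -> Y) (g : B * bool -> Y -> Y)
    (tau : Y -> Y) (l : (A + B) * bool) (y : Y) : Y :=
  match l.1 with
  | inl a => f (a, l.2) y
  | inr b => tau (g (b, l.2) (tau y))
  end.

Lemma twist_emb_l (A B Y : Type) (f : A * bool -> Y -> Y) (g : B * bool -> Y -> Y)
    (tau : Y -> Y) (w : word A) (y : Y) :
  wact (twist f g tau) (emb_l w) y = wact f w y.
Proof. by elim: w => //= -[a b] w IH; rewrite IH. Qed.

Lemma twist_emb_r (A B Y : Type) (f : A * bool -> Y -> Y) (g : B * bool -> Y -> Y)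
    (tau : Y -> Y) (w : word B) (y : Y) :
  involutive tau -> wact (twist f g tau) (emb_r w) y = tau (wact g w (tau y)).
Proof. by move=> tauK; elim: w => [|[a b] w IH] /=; rewrite ?tauK // IH /twist /= tauK. Qed.

Lemma twist_amalg_eq (A B Y : Type) (c : word A) (d : word B)
    (f : A * bool -> Y -> Y) (g : B * bool -> Y -> Y) (tau : Y -> Y)
    (u v : word (A + B)) :
  (forall l, cancel (f (linv l)) (f l)) -> (forall l, cancel (g (linv l)) (g l)) ->
  involutive tau -> (forall y, wact f c y = tau (wact g d (tau y))) ->
  amalg_eq c d u v -> wact (twist f g tau) u =1 wact (twist f g tau) v.
Proof.
move=> fK gK tauK fg; apply: wact_weq => _ _ [[[[a|b] e]]|[-> ->]] z.
- exact: (fK (a, e)).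
- by rewrite /= /twist /= tauK (gK (b, e)).
- by rewrite twist_emb_l twist_emb_r.
Qed.

Lemma amalg_extends_cancel (A B : Type) (c : word A) (d : word B) :
  extends_cancel (amalg_rel c d).
Proof. by move=> x y; left. Qed.
#[local] Hint Resolve amalg_extends_cancel : core.

Lemma amalg_eq_cd (A B : Type) (c : word A) (d : word B) :
  amalg_eq c d (emb_l c) (emb_r d).
Proof. by apply: weq_rel; right. Qed.

(** * Reduced words and the free group acting on them *)

Lemma linv_inj (I : Type) : injective (@linv I).
Proof. exact: inv_inj (@linvK I). Qed.

Lemma eq_linvC (I : eqType) (a b : I * bool) : (a == linv b) = (b == linv a).
Proof. by rewrite eq_sym (inv_eq (@linvK I)). Qed.

Lemma reduced_winv (I : eqType) (w : word I) : reduced (winv w) = reduced w.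
Proof.
rewrite /reduced /winv rev_sorted sorted_map.
case: w => // a w; elim: w a => //= b w IH a; rewrite IH; congr andb.
by rewrite (inj_eq (@linv_inj I)) eq_linvC.
Qed.

Lemma cyc_reduced_reduced_winv (I : eqType) (w : word I) :
  cyc_reduced w -> cyc_reduced (winv w).
Proof.
case/andP=> rw; rewrite /cyc_reduced reduced_winv rw.
case/lastP: w {rw} => // w l; rewrite /winv map_rcons rev_rcons.
case: w => [|a w] /=; first by rewrite (inj_eq (@linv_inj I)).
by rewrite rev_cons !last_rcons (inj_eq (@linv_inj I)) eq_linvC.
Qed.

Lemma reduced_wexp (I : eqType) (w : word I) (n : nat) :
  cyc_reduced w -> reduced (wexp w n).
Proof.
case/andP; case: w => [|a w]; first by elim: n.
rewrite /reduced /= => rw aw; case: n => // n.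
rewrite wexpS /= cat_path rw /=; elim: n => // n IH.
by rewrite wexpS /= cat_path rw IH !andbT eq_linvC.
Qed.

Definition lmul_reduced {I : eqType} (l : I * bool) (w : word I) : word I :=
  if w is a :: w' then if a == linv l then w' else l :: w else [:: l].

Lemma lmul_reducedP (I : eqType) (l : I * bool) (w : word I) :
  reduced w -> reduced (lmul_reduced l w).
Proof.
case: w => //= a w; case: eqVneq => [_|al] rw; first exact: path_sorted rw.
by rewrite /reduced /= al.
Qed.

Lemma lmul_reducedK (I : eqType) (l : I * bool) (w : word I) :
  reduced w -> lmul_reduced l (lmul_reduced (linv l) w) = w.
Proof.
case: w => [|a w] /=; first by rewrite eqxx.
rewrite linvK; case: eqVneq => [->|al] /=; last by rewrite eqxx.
by rewrite /reduced; case: w => //= b w /andP[/negbTE ->].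
Qed.

Lemma free_eq_lmul_reduced (I : eqType) (l : I * bool) (w : word I) :
  free_eq (lmul_reduced l w) (l :: w).
Proof.
case: w => [|a w] /=; first exact: rst_refl.
case: eqVneq => [->|_]; last exact: rst_refl.
apply: rst_sym; apply: (@weq_cat _ _ [:: l; linv l] [::] _ w w).
  exact: weq_rel.
exact: rst_refl.
Qed.

(** The carrier of van der Waerden's representation: the free group acts on reduced words by
    multiplying and cancelling, which yields uniqueness of normal forms without a confluence
    argument. *)
Definition rword (I : eqType) := {w : word I | reduced w}.

Definition rword_lmul {I : eqType} (l : I * bool) (x : rword I) : rword I :=
  exist _ (lmul_reduced l (val x)) (lmul_reducedP l (valP x)).

Lemma rword_lmulK (I : eqType) (l : I * bool) :
  cancel (@rword_lmul I (linv l)) (rword_lmul l).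
Proof. by case=> w rw; apply: val_inj; exact: lmul_reducedK. Qed.

Definition rword1 {I : eqType} : rword I := exist _ [::] isT.

Lemma free_eq_rword_act (I : eqType) (u : word I) (x : rword I) :
  free_eq (val (wact rword_lmul u x)) (u ++ val x).
Proof.
elim: u => [|l u IH] /=; first exact: rst_refl.
apply: rst_trans (free_eq_lmul_reduced _ _) _.
rewrite -cat1s -[l :: _ ++ _]cat1s; apply: weq_cat IH; exact: rst_refl.
Qed.

Lemma rword_act1 (I : eqType) (u : word I) :
  reduced u -> val (wact rword_lmul u rword1) = u.
Proof.
elim: u => //= l u IH rlu; rewrite IH; last exact: path_sorted rlu.
by case: u rlu {IH} => //= a u /andP[/negbTE ->].
Qed.

(** Cancelling [x] makes [u] freely equal to the empty word; but a reduced [u] applied to the empty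
    word returns [u] itself. *)
Lemma rword_act_free (I : eqType) (u : word I) (x : rword I) :
  reduced u -> wact rword_lmul u x = x -> u = [::].
Proof.
move=> ru ux; rewrite -(rword_act1 ru).
have E : free_eq (u ++ val x) ([::] ++ val x).
  by rewrite -{2}ux; apply: rst_sym; exact: free_eq_rword_act.
have {}E := weq_cancel_r (fun _ _ => id) E.
by rewrite (wact_free_eq (@rword_lmulK I) E).
Qed.

(** * Free actions of the integers and injectivity of the first factor *)

Definition cyc_act {I : eqType} (c : word I) (k : int) : rword I -> rword I :=
  wact rword_lmul (wpow c k).

Lemma cyc_actD (I : eqType) (c : word I) (a b : int) x :
  cyc_act c (a + b)%R x = cyc_act c a (cyc_act c b x).
Proof.
rewrite /cyc_act -wact_cat.
by apply: (wact_free_eq (@rword_lmulK I)); apply: wpowD.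
Qed.

Lemma cyc_act1 (I : eqType) (c : word I) x :
  cyc_act c 1%R x = wact rword_lmul c x.
Proof. by rewrite /cyc_act /wpow /wexp /= cats0. Qed.

(** Powers of a cyclically reduced word are reduced, so one that fixes a point has length zero. *)
Lemma cyc_act_free (I : eqType) (c : word I) (k : int) x :
  cyc_reduced c -> c <> [::] -> cyc_act c k x = x -> k = 0%R.
Proof.
move=> rc c0; wlog: k / (0 <= k)%R => [wl|].
  case: (lerP 0 k) => [/wl //|k0] kx.
  suff : (- k = 0)%R by move/eqP; rewrite oppr_eq0 => /eqP.
  apply: wl; first by lia.
  by rewrite -{1}kx -cyc_actD addNr.
case: k => // n _ /(rword_act_free (reduced_wexp n rc)) /(congr1 size) /=.
by rewrite size_wexp; case: c c0 {rc} => // a c _ /=; nia.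
Qed.

(** Trivialises a free action of the integers: [rep] is a base point on each orbit, [idx] the
    position relative to it. *)
Lemma free_int_action_coords (T : choiceType) (e : int -> T -> T) :
  (forall x, e 0%R x = x) -> (forall a b x, e (a + b)%R x = e a (e b x)) ->
  (forall k x, e k x = x -> k = 0%R) ->
  exists (rep : T -> T) (idx : T -> int),
    [/\ forall x, e (idx x) (rep x) = x, forall k x, rep (e k x) = rep x
      & forall k x, idx (e k x) = (k + idx x)%R].
Proof.
move=> e0 eD efree.
pose P x : pred T := fun y => `[< exists k, e k y = x >].
pose rep x := choose (P x) x.
have Px x : P x x by apply/asboolP; exists 0%R.
have Prep x : exists k, e k (rep x) = x by exact/asboolP/(chooseP (Px x)).
have [idx idxP] := choice Prep.
have idxE x : e (idx x) (rep x) = x := idxP x.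
have repE k x : rep (e k x) = rep x.
  have PE : P (e k x) = P x.
    apply/funext => y; apply/asbool_equiv_eq; split=> -[a ya].
      by exists (- k + a)%R; rewrite eD ya -eD addNr e0.
    by exists (k + a)%R; rewrite eD ya.
  (* [choose] depends only on the predicate, which is the same for all points of one orbit. *)
  rewrite /rep PE; apply: choose_id; last exact: Px.
  by rewrite -PE; exact: Px.
exists rep, idx; split=> // k x.
have E : e (- (k + idx x) + idx (e k x))%R (rep x) = rep x.
  by rewrite eD -{1}(repE k x) idxE -{2}(idxE x) -(eD k) -eD addNr e0.
by move/efree/eqP: E; rewrite addrC subr_eq0 => /eqP.
Qed.

(* Faithfulness of the first factor: on pairs of reduced words, [c]
   and [d] act freely on their own factor, and exchanging the positions along the
   orbits of [c] and [d] conjugates one action to the other. *)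
Lemma emb_l_inj (A B : countType) (c : word A) (d : word B) (u v : word A) :
  cyc_reduced c -> cyc_reduced d -> c <> [::] -> d <> [::] ->
  amalg_eq c d (emb_l u) (emb_l v) ->
  wact rword_lmul u =1 wact rword_lmul v.
Proof.
move=> rc rd c0 d0 E x.
have [repc [idxc [cE repcE idxcE]]] := free_int_action_coords
  (fun _ => erefl) (@cyc_actD A c) (fun k x => @cyc_act_free A c k x rc c0).
have [repd [idxd [dE repdE idxdE]]] := free_int_action_coords
  (fun _ => erefl) (@cyc_actD B d) (fun k x => @cyc_act_free B d k x rd d0).
(* In coordinates, with base points r and s, [theta] sends (c^a r, d^b s) to (c^b r, d^a s). *)
pose theta (p : rword A * rword B) :=
  (cyc_act c (idxd p.2) (repc p.1), cyc_act d (idxc p.1) (repd p.2)).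
pose f (l : A * bool) (p : rword A * rword B) := (rword_lmul l p.1, p.2).
pose g (l : B * bool) (p : rword A * rword B) := (p.1, rword_lmul l p.2).
have fE w p : wact f w p = (wact rword_lmul w p.1, p.2).
  by elim: w => [|l w /= ->]; case: p.
have gE w p : wact g w p = (p.1, wact rword_lmul w p.2).
  by elim: w => [|l w /= ->]; case: p.
have rr1 y : repc (repc y) = repc y by rewrite -{2}(cE y) repcE.
have rr2 y : repd (repd y) = repd y by rewrite -{2}(dE y) repdE.
have ir1 y : idxc (repc y) = 0%R.
  by apply: (addrI (idxc y)); rewrite -idxcE cE addr0.
have ir2 y : idxd (repd y) = 0%R.
  by apply: (addrI (idxd y)); rewrite -idxdE dE addr0.
have thetaK : involutive theta.
  case=> a b; rewrite /theta /= !repcE !repdE !idxcE !idxdE rr1 rr2 ir1 ir2 !addr0.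
  by rewrite cE dE.
have cd p : wact f c p = theta (wact g d (theta p)).
  case: p => a b; rewrite fE gE /theta /= -!cyc_act1 -cyc_actD.
  rewrite !repcE !repdE !idxcE !idxdE rr1 rr2 ir1 ir2 !addr0.
  by rewrite cyc_actD cE dE.
have := twist_amalg_eq (f := f) (g := g) _ _ thetaK cd E.
have fK l : cancel (f (linv l)) (f l).
  by case=> a b; rewrite /f /= rword_lmulK.
have gK l : cancel (g (linv l)) (g l).
  by case=> a b; rewrite /g /= rword_lmulK.
move=> /(_ fK gK (x, rword1)); rewrite !twist_emb_l !fE.
by case.
Qed.

(** * Exponent sums as heights of words *)

Lemma expsum_cons (I : eqType) (i : I) l (w : word I) :
  expsum i (l :: w) = (expsum i [:: l] + expsum i w)%R.
Proof. by rewrite -cat1s /expsum big_cat. Qed.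

Lemma expsum_nil (I : eqType) (i : I) : expsum i [::] = 0%R.
Proof. by rewrite /expsum big_nil. Qed.

Lemma expsum_cat (I : eqType) (i : I) (u v : word I) :
  expsum i (u ++ v) = (expsum i u + expsum i v)%R.
Proof. by rewrite /expsum big_cat. Qed.

Lemma expsum_linv (I : eqType) (i : I) l :
  expsum i [:: linv l] = (- expsum i [:: l])%R.
Proof.
case: l => a b; rewrite /expsum !big_cons !big_nil /=.
by case: (a == i); case: b; rewrite /= ?addr0 ?opprK ?oppr0.
Qed.

Lemma expsum_winv (I : eqType) (i : I) (w : word I) :
  expsum i (winv w) = (- expsum i w)%R.
Proof.
elim: w => [|l w IH]; first by rewrite expsum_nil oppr0.
by rewrite -cat1s winv_cat !expsum_cat IH opprD addrC -expsum_linv.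
Qed.

Lemma expsum_weq (I : eqType) (i : I) (R : word I -> word I -> Prop) u v :
  (forall x y, R x y -> expsum i x = expsum i y) ->
  weq R u v -> expsum i u = expsum i v.
Proof.
move=> hR; elim=> {u v} [u v [p [q [x [y [Rxy [-> ->]]]]]]|//|//|u v w _ -> _ -> //].
by rewrite !expsum_cat (hR _ _ Rxy).
Qed.

Lemma expsum_cancel_rel (I : eqType) (i : I) (u v : word I) :
  cancel_rel u v -> expsum i u = expsum i v.
Proof. by case=> l; rewrite expsum_cons expsum_linv addrN expsum_nil. Qed.

Lemma expsum_bound (I : eqType) (i : I) (w : word I) :
  (`|expsum i w| <= (size w)%:Z)%R.
Proof.
elim: w => [|l w IH]; first by rewrite expsum_nil.
have : (`|expsum i [:: l]| <= 1)%R.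
  by rewrite /expsum big_cons big_nil; case: (_ == i) => //; case: l.2.
by rewrite (expsum_cons i l w) /=; lia.
Qed.

Lemma expsum_nseq (I : eqType) (i : I) n : expsum i (nseq n (i, false)) = (n%:Z)%R.
Proof.
elim: n => [|n IH]; first exact: expsum_nil.
by rewrite /= expsum_cons IH /expsum big_cons big_nil eqxx /=; lia.
Qed.

Lemma expsum_wexp (I : eqType) (i : I) (w : word I) n :
  expsum i w = 0%R -> expsum i (wexp w n) = 0%R.
Proof.
move=> w0; elim: n => [|n IH]; first exact: expsum_nil.
by rewrite wexpS expsum_cat w0 IH.
Qed.

(** A suffix of a power of [w] is a suffix of [w] followed by full copies of [w], which have height
    zero. *)
Lemma expsum_drop_wexp (I : eqType) (i : I) (w : word I) n k :
  expsum i w = 0%R -> (`|expsum i (drop k (wexp w n))| <= (size w)%:Z)%R.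
Proof.
move=> w0; elim: n k => [|n IH] k; first by rewrite expsum_nil.
rewrite wexpS drop_cat; case: ifP => _; last exact: IH.
rewrite expsum_cat expsum_wexp // addr0.
by have := expsum_bound i (drop k w); rewrite size_drop; lia.
Qed.

(** * Cancellation against powers of a generator *)

Lemma val_rword_act (I : eqType) (u : word I) (x : rword I) :
  val (wact rword_lmul u x) = foldr lmul_reduced (val x) u.
Proof. by elim: u => //= l u ->. Qed.

Lemma expsum_rword_act (I : eqType) (i : I) (u z : word I) :
  expsum i (foldr lmul_reduced z u) = (expsum i u + expsum i z)%R.
Proof.
rewrite -expsum_cat; elim: u => //= l u IH.
rewrite (expsum_weq (@expsum_cancel_rel I i) (free_eq_lmul_reduced _ _)).
by rewrite expsum_cons IH -expsum_cons.
Qed.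

(** Each letter of [u] cancels at most one letter of [z]. *)
Lemma foldr_lmul_reduced_suffix (I : eqType) (u z : word I) :
  exists p k, k <= size u /\ foldr lmul_reduced z u = p ++ drop k z.
Proof.
elim: u => [|l u [p [k [ku /= ->]]]]; first by exists [::], 0; rewrite drop0.
case: p => [|a p] /=.
  rewrite /lmul_reduced; case E : (drop k z) => [|a s].
    by exists [:: l], k; rewrite E; split=> //; lia.
  case: eqP => _; first by exists [::], k.+1; rewrite -[k.+1]add1n -drop_drop E /= drop0.
  by exists [:: l], k; rewrite E; split=> //; lia.
case: eqP => _; first by exists p, k; split=> //; lia.
by exists [:: l, a & p], k; split=> //; lia.
Qed.

(* Cancelling more than [q] letters of [t^M] would bring the height below [M - q]. *)
Lemma foldr_lmul_reduced_power (I : eqType) (i : I) (u : word I) (q M : nat) :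
  q <= M -> (forall k, - q%:Z <= expsum i (drop k u))%R ->
  exists p, foldr lmul_reduced (nseq M (i, false)) u = p ++ nseq (M - q) (i, false).
Proof.
move=> qM; elim: u => [|l u IH] hu.
  by exists (nseq q (i, false)); rewrite -nseqD subnKC.
have [|p /= E] := IH; first by move=> k; exact: (hu k.+1).
have H := expsum_rword_act i (l :: u) (nseq M (i, false)).
move: H (hu 0); rewrite drop0 expsum_nseq /= E => H h0.
case: p E H => [|a p] E /=.
  (* Only the bare power of height M - q is left; a further cancellation would lower the height to M
     - q - 1, against [h0]. *)
  rewrite /lmul_reduced; case Mq : (M - q) => [|r] /=; first by exists [:: l].
  case: eqP => _; last by exists [:: l].
  by rewrite expsum_nseq; lia.
by case: eqP => _ _; [exists p | exists [:: l, a & p]].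
Qed.

Lemma wact_wexp_comm (I Y : Type) (f : I * bool -> Y -> Y) (u v w : word I) n y :
  (forall y, wact f (u ++ v) y = wact f (v ++ w) y) ->
  wact f (wexp u n ++ v) y = wact f (v ++ wexp w n) y.
Proof.
move=> E; elim: n y => [|n IH] y; first by rewrite /wexp /= cats0.
by rewrite wexpS -catA wact_cat IH catA !wact_cat -[RHS]wact_cat -E wact_cat.
Qed.

(** Treats both signs of [k] at once: [x] is [c] or its inverse. *)
Lemma wpowE (I : eqType) (i : I) (c : word I) (k : int) :
  cyc_reduced c -> expsum i c = 0%R ->
  exists x, [/\ cyc_reduced x, expsum i x = 0%R, size x = size c
    & wpow c k = wexp x `|k|%N].
Proof.
move=> rc c0; case: k => n; first by exists c.
exists (winv c); split; rewrite ?size_winv ?expsum_winv ?c0 ?oppr0 //.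
exact: cyc_reduced_reduced_winv.
Qed.

(* The axis of [c] has bounded height, hence is moved off itself by [t^M]. *)
Lemma power_conj_cyclic (A B : countType) (c : word A) (d : word B) (i : A)
    (k k' : int) (M : nat) :
  cyc_reduced c -> cyc_reduced d -> c <> [::] -> d <> [::] ->
  expsum i c = 0%R -> 2 * size c < M ->
  amalg_eq c d (emb_l (wpow c k ++ nseq M (i, false)))
               (emb_l (nseq M (i, false) ++ wpow c k')) ->
  k' = 0%R.
Proof.
move=> rc rd c0 d0 ec hM E.
have {}E := emb_l_inj rc rd c0 d0 E.
have [x [rx ex sx kx]] := wpowE k' rc ec.
have [y [ry ey sy ky]] := wpowE k rc ec.
apply/eqP; rewrite -absz_eq0; apply/negPn/negP => k'0.
have sc : 0 < size c by case: c c0 {rc ec hM E kx ky sx sy}.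
(* The relation is raised to the power [N], so large that more than [size c] letters of the power of
   [x] survive after [M] of them are cancelled. *)
have [N NE] : {N | N = M + size c + 1} by eexists.
have := congr1 val (wact_wexp_comm N rword1 E).
rewrite kx ky !wexpM !wact_cat.
rewrite val_rword_act rword_act1; last by elim: (M) => // -[|n] //= ->; rewrite /linv eqE /= andbF.
(* The left side ends in at least [M - size c] letters t, hence in more than [size c] of them. *)
have [||p ->] := @foldr_lmul_reduced_power A i (wexp y (`|k|%N * N)) (size c) M.
- by lia.
- by move=> j; have := expsum_drop_wexp (`|k|%N * N) j ey; rewrite sy ler_norml => /andP[].
rewrite val_rword_act rword_act1; last exact: reduced_wexp.
have [p' [j [jM ->]]] := foldr_lmul_reduced_suffix (nseq M (i, false)) (wexp x (`|k'|%N * N)).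
rewrite size_nseq in jM => F.
have sz := congr1 size F; rewrite !size_cat size_nseq size_drop size_wexp sx in sz.
have big : N <= `|k'|%N * N * size c.
  rewrite -mulnA; apply: leq_trans (leq_pmulr N sc) _.
  by rewrite leq_pmull // lt0n.
move: big sz F; set n := `|k'|%N * N; move=> big sz F.
(* The last [size c + 1] letters are compared: on the left a power of t of height [size c + 1], on
   the right a suffix of a power of [x], of height at most [size c]. *)
have := congr1 (drop (size p + (M - size c) - (size c).+1)) F.
have big2 : (size c).+1 <= n * size c - j.
  by move: (size c) (n * size c) NE big jM => q r; lia.
have big1 : (size c).+1 <= M - size c by move: (size c) hM => q; lia.
rewrite drop_cat ifF; last by apply/negbTE; rewrite -leqNgt -addnBA // leq_addr.
rewrite [in RHS]sz drop_cat ifF; last by apply/negbTE; rewrite -leqNgt -addnBA // leq_addr.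
rewrite drop_drop drop_nseq => /(congr1 (expsum i)); rewrite expsum_nseq => h.
have := expsum_drop_wexp n (size p' + (n * size c - j) - (size c).+1 - size p' + j) ex.
rewrite -h ger0_norm // sx -addnBA // addKn subKn //.
by rewrite lez_nat ltnn.
Qed.

(** * Cosets of the amalgamated cyclic subgroup *)

Lemma choose_class_eq (T : choiceType) (E : T -> T -> Prop) (u v : T) :
  (forall x, E x x) -> (forall x y, E x y -> E y x) ->
  (forall x y z, E x y -> E y z -> E x z) -> E u v ->
  choose (fun x => `[< E x u >]) u = choose (fun x => `[< E x v >]) v.
Proof.
move=> Er Es Et Euv.
have -> : (fun x => `[< E x u >]) = (fun x => `[< E x v >]).
  apply/funext => x; apply/asbool_equiv_eq; split=> [xu|xv]; first exact: Et Euv.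
  by apply: Et xv _; exact: Es.
by apply: choose_id; apply/asboolP.
Qed.

Section AmalgAction.

Variables (A B : countType) (c : word A) (d : word B) (i : A) (j : B).

Definition coset_eq (u v : word (A + B)) : Prop :=
  exists k : int, amalg_eq c d u (v ++ wpow (emb_l c) k).

Lemma amalg_coset_eq u v : amalg_eq c d u v -> coset_eq u v.
Proof. by move=> E; exists 0%R; rewrite cats0. Qed.

Lemma coset_eq_refl u : coset_eq u u.
Proof. exact/amalg_coset_eq/rst_refl. Qed.

Lemma coset_eq_sym u v : coset_eq u v -> coset_eq v u.
Proof.
move=> [k E]; exists (- k)%R; rewrite /amalg_eq E -catA -wpowD // addrN cats0.
exact: rst_refl.
Qed.

Lemma coset_eq_trans u v w : coset_eq u v -> coset_eq v w -> coset_eq u w.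
Proof.
move=> [k E] [k' E']; exists (k' + k)%R; rewrite /amalg_eq E E' wpowD // catA.
exact: rst_refl.
Qed.

Lemma coset_eq_cat u v w : coset_eq v w -> coset_eq (u ++ v) (u ++ w).
Proof. by move=> [k E]; exists k; rewrite /amalg_eq E catA; exact: rst_refl. Qed.

Definition coset_repr (u : word (A + B)) : word (A + B) :=
  choose (fun v => `[< coset_eq v u >]) u.

Lemma coset_reprP u : coset_eq (coset_repr u) u.
Proof.
have /(chooseP (P := fun v => `[< coset_eq v u >])) /asboolP : `[< coset_eq u u >].
  exact/asboolP/coset_eq_refl.
by [].
Qed.

Lemma coset_repr_eq u v : coset_eq u v -> coset_repr u = coset_repr v.
Proof.
exact: (choose_class_eq coset_eq_refl coset_eq_sym coset_eq_trans).
Qed.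

Lemma coset_reprK u : coset_repr (coset_repr u) == coset_repr u.
Proof. exact/eqP/coset_repr_eq/coset_reprP. Qed.

(** A left coset is encoded by its chosen representative, so that cosets form a countable type with
    decidable equality. *)
Definition coset : Type := {u : word (A + B) | coset_repr u == u}.

Definition coset_of (u : word (A + B)) : coset := exist _ (coset_repr u) (coset_reprK u).

Lemma coset_of_eq u v : coset_eq u v -> coset_of u = coset_of v.
Proof. by move=> E; apply: val_inj; exact: coset_repr_eq. Qed.

Lemma coset_of_inj u v : coset_of u = coset_of v -> coset_eq u v.
Proof.
move=> /(congr1 val) /= E; apply: coset_eq_trans (coset_reprP v).
by rewrite -E; exact/coset_eq_sym/coset_reprP.
Qed.

Lemma coset_valK (x : coset) : coset_of (val x) = x.
Proof. by apply: val_inj; exact/eqP/(valP x). Qed.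

Definition coset_lmul (l : (A + B) * bool) (x : coset) : coset := coset_of (l :: val x).

Lemma coset_lmul_of l u : coset_lmul l (coset_of u) = coset_of (l :: u).
Proof. by apply: coset_of_eq; apply: (@coset_eq_cat [:: l]); exact: coset_reprP. Qed.

Lemma coset_lmulK l : cancel (coset_lmul (linv l)) (coset_lmul l).
Proof.
move=> x; rewrite -(coset_valK x) !coset_lmul_of; apply: coset_of_eq.
apply: (@amalg_coset_eq ([:: l; linv l] ++ val x) ([::] ++ val x)).
by apply: weq_cat; [exact/weq_rel/amalg_extends_cancel | exact: rst_refl].
Qed.

(** * The twisted action on the integers and the cosets *)

Definition amalg_point : Type := (int + coset)%type.

Definition act_l (l : A * bool) (y : amalg_point) : amalg_point :=
  match y with
  | inl z => inl (z + expsum i [:: l])%R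
  | inr x => inr (coset_lmul (inl l.1, l.2) x)
  end.

Definition act_r (l : B * bool) (y : amalg_point) : amalg_point :=
  match y with
  | inl z => inl (z + expsum j [:: l])%R
  | inr x => inr (coset_lmul (inr l.1, l.2) x)
  end.

(** The point -1 lies just below the ray of nonnegative integers: the ray is left fixed, yet the
    inverse of [j] leads from 0 to the coset C. *)
Definition swap_base (y : amalg_point) : amalg_point :=
  match y with
  | inl z => if z == (- 1)%R then inr (coset_of [::]) else inl z
  | inr x => if x == coset_of [::] then inl (- 1)%R else inr x
  end.

Lemma swap_baseK : involutive swap_base.
Proof.
case=> [z|x] /=; first by case: (eqVneq z) => [->|/negbTE zn] /=; rewrite ?eqxx ?zn.
by case: (eqVneq x) => [->|/negbTE xn] /=; rewrite ?eqxx ?xn.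
Qed.

Lemma act_lK l : cancel (act_l (linv l)) (act_l l).
Proof.
case=> [z|x] /=; first by rewrite expsum_linv addrNK.
by rewrite (coset_lmulK (inl l.1, l.2)).
Qed.

Lemma act_rK l : cancel (act_r (linv l)) (act_r l).
Proof.
case=> [z|x] /=; first by rewrite expsum_linv addrNK.
by rewrite (coset_lmulK (inr l.1, l.2)).
Qed.

Lemma wact_act_l_int w z : wact act_l w (inl z) = inl (z + expsum i w)%R.
Proof.
elim: w => [|l w IH] /=; first by rewrite expsum_nil addr0.
by rewrite IH (expsum_cons i l w) /= -addrA (addrC (expsum i w)).
Qed.

Lemma wact_act_r_int w z : wact act_r w (inl z) = inl (z + expsum j w)%R.
Proof.
elim: w => [|l w IH] /=; first by rewrite expsum_nil addr0.
by rewrite IH (expsum_cons j l w) /= -addrA (addrC (expsum j w)).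
Qed.

Lemma wact_act_l_coset w u :
  wact act_l w (inr (coset_of u)) = inr (coset_of (emb_l w ++ u)).
Proof. by elim: w => //= l w ->; rewrite /= coset_lmul_of. Qed.

Lemma wact_act_r_coset w u :
  wact act_r w (inr (coset_of u)) = inr (coset_of (emb_r w ++ u)).
Proof. by elim: w => //= l w ->; rewrite /= coset_lmul_of. Qed.

Lemma coset_of_emb_r_d u : coset_of (emb_r d ++ u) = coset_of (emb_l c ++ u).
Proof.
apply/coset_of_eq/amalg_coset_eq; apply: weq_cat (rst_refl _ _ _).
exact/rst_sym/amalg_eq_cd.
Qed.

Lemma coset_of_emb_l_c : coset_of (emb_l c) = coset_of [::].
Proof.
by apply: coset_of_eq; exists 1%R; rewrite /wpow /wexp /= cats0; exact: rst_refl.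
Qed.

Lemma coset_of_c_cat u :
  (coset_of (emb_l c ++ u) == coset_of [::]) = (coset_of u == coset_of [::]).
Proof.
apply/eqP/eqP => /coset_of_inj E; last first.
  rewrite -[RHS]coset_of_emb_l_c; apply: coset_of_eq.
  by rewrite -{2}(cats0 (emb_l c)); exact: coset_eq_cat.
have {E} [k E] : coset_eq (emb_l c ++ u) (emb_l c).
  by apply: coset_eq_trans E _; apply/coset_eq_sym/coset_of_inj/coset_of_emb_l_c.
apply: coset_of_eq; exists k; apply: (weq_cancel_l (x := emb_l c)) => //.
Qed.

Definition amalg_act (w : word (A + B)) : amalg_point -> amalg_point :=
  wact (twist act_l act_r swap_base) w.

Lemma amalg_act_cat u v y : amalg_act (u ++ v) y = amalg_act u (amalg_act v y).
Proof. exact: wact_cat. Qed.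

Lemma amalg_act_power K z :
  amalg_act (nseq K (inl i, false)) (inl z) = inl (z + K%:Z)%R.
Proof.
elim: K => [|K IH]; first by rewrite addr0.
rewrite /= -/(amalg_act _) IH /twist /= /expsum big_cons big_nil eqxx /=.
by congr inl; lia.
Qed.

(** Each letter moves an integer by at most one, so a start at [size w] or above keeps the path off
    the swapped point -1. *)
Lemma amalg_act_ray w : exists2 k : int, (`|k| <= (size w)%:Z)%R &
  forall z : int, ((size w)%:Z <= z)%R -> amalg_act w (inl z) = inl (z + k)%R.
Proof.
elim: w => [|l w [k kw IH]]; first by exists 0%R => // z _; rewrite addr0.
pose e := (match l.1 with inl a => expsum i [:: (a, l.2)]
                        | inr b => expsum j [:: (b, l.2)] end).
have e1 : (`|e| <= 1)%R.
  by rewrite /e; case: l.1 => a; exact: (expsum_bound _ [:: _]).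
exists (k + e)%R => /= [|z zw]; first by lia.
rewrite -/(amalg_act _) IH; last by lia.
rewrite addrA /twist /e; case: l.1 @e e1 => a e e1 //=.
rewrite (_ : _ == _ = false) /=; last by apply/negbTE/eqP; lia.
rewrite ifF //; apply/negbTE/eqP; rewrite /e in e1; lia.
Qed.

(** Once in the coset C, the letters [i] act by plain left multiplication, since the first factor is
    not conjugated. *)
Lemma amalg_act_enter K :
  amalg_act (nseq K (inl i, false) ++ [:: (inr j, true)]) (inl 0%R) =
    inr (coset_of (nseq K (inl i, false))).
Proof.
have E : expsum j [:: (j, true)] = (- 1)%R.
  by rewrite /expsum big_cons big_nil eqxx /= addr0.
rewrite amalg_act_cat /amalg_act /= {2}/twist /= E /=.
by elim: K => //= K ->; rewrite /twist /= coset_lmul_of.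
Qed.

Hypothesis c_height0 : expsum i c = 0%R.
Hypothesis d_height0 : expsum j d = 0%R.

(** On the integers both words act trivially, having height zero; [c] and [d] fix the coset C; the
    other cosets avoid the swap before and after, and there c = d in the amalgam. *)
Lemma act_cd y : wact act_l c y = swap_base (wact act_r d (swap_base y)).
Proof.
case: y => [z|x] /=.
  rewrite wact_act_l_int c_height0 addr0; case: eqP => [->|/eqP/negbTE zn].
    by rewrite wact_act_r_coset coset_of_emb_r_d /= cats0 coset_of_emb_l_c eqxx.
  by rewrite wact_act_r_int d_height0 addr0 /= zn.
rewrite -(coset_valK x) wact_act_l_coset; case: eqP => [E|/eqP/negbTE xn].
  rewrite wact_act_r_int d_height0 addr0 /=; congr inr; apply/eqP.
  by rewrite coset_of_c_cat E.
by rewrite wact_act_r_coset coset_of_emb_r_d /= coset_of_c_cat xn.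
Qed.

Lemma amalg_act_weq u v : amalg_eq c d u v -> amalg_act u =1 amalg_act v.
Proof. exact: twist_amalg_eq act_lK act_rK swap_baseK act_cd. Qed.

(** [c] has height zero and letters from [B] do not count, so neither the relation c = d nor a right
    factor c^k changes the height. *)
Lemma expsum_coset_eq u v : coset_eq u v -> expsum (inl i) u = expsum (inl i) v.
Proof.
have expl (w : word A) : expsum (inl i) (@emb_l A B w) = expsum i w.
  elim: w => [|l w IH]; first by rewrite !expsum_nil.
  rewrite (expsum_cons i l) /= -IH (expsum_cons _ _ (emb_l w)).
  by rewrite /expsum !big_cons !big_nil.
have expr (w : word B) : expsum (inl i) (@emb_r A B w) = 0%R.
  elim: w => [|l w IH]; first by rewrite !expsum_nil.
  by rewrite /= (expsum_cons _ _ (emb_r w)) IH /expsum !big_cons !big_nil.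
move=> [k E]; rewrite wpow_emb_l in E.
rewrite (expsum_weq _ E) => [|x y [|[-> ->]]]; last 2 first.
- exact: expsum_cancel_rel.
- by rewrite expl expr.
rewrite expsum_cat expl; case: k {E} => n; rewrite /wpow expsum_wexp ?addr0 //.
by rewrite expsum_winv c_height0 oppr0.
Qed.

(* Far from the swapped point, in the height given by the exponent of [i], the
   new action is still left multiplication. *)
Lemma amalg_act_far w u : ((size w)%:Z < `|expsum (inl i) u|)%R ->
  amalg_act w (inr (coset_of u)) = inr (coset_of (w ++ u)).
Proof.
elim: w => // l w IH /= hw; rewrite -/(amalg_act _) IH; last first.
  by apply: Order.POrderTheory.lt_trans hw; rewrite ltz_nat.
(* A coset of nonzero height differs from C, hence is untouched by the swap. *)
have nb v : (0 < `|expsum (inl i) v|)%R -> (coset_of v == coset_of [::]) = false.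
  move=> v0; apply/negbTE/eqP => /coset_of_inj /expsum_coset_eq E.
  by move: v0; rewrite E expsum_nil normr0.
have hwu : (0 < `|expsum (inl i) (w ++ u)|)%R.
  rewrite expsum_cat; move: hw (expsum_bound (inl i) w).
  by move: (expsum _ u) (expsum _ w) (size w) => a b n; lia.
case: l hw => -[a|b] e hw; rewrite /twist /= ?coset_lmul_of //.
rewrite nb //= coset_lmul_of nb //.
by rewrite expsum_cons /expsum big_cons big_nil /= add0r.
Qed.

End AmalgAction.

(** * Countable sets, finite index, and amenability along a ray *)

Lemma infinite_countType_bij (U V : countType) :
  (forall s : seq U, exists x, x \notin s) -> (forall s : seq V, exists x, x \notin s) ->
  exists (f : U -> V) (g : V -> U), cancel f g /\ cancel g f.
Proof.
have natbij (W : countType) : (forall s : seq W, exists x, x \notin s) ->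
    exists (f : W -> nat) (g : nat -> W), cancel f g /\ cancel g f.
  move=> Winf; have /card_set_bijP[f] : ([set: W] #= [set: nat])%card.
    apply: eq_card_nat => [|/finite_seqP[s sT]]; first exact: countableP.
    have [x /negP[]] := Winf s.
    by have : [set: W]%classic x by []; rewrite sT.
  by rewrite setTT_bijective => -[g fK gK]; exists f, g.
move=> /natbij[f [f' [fK f'K]]] /natbij[g [g' [gK g'K]]].
exists (g' \o f), (f' \o g).
by split=> x /=; rewrite ?g'K ?f'K ?fK ?gK.
Qed.

(** Pigeonhole on the first [size ts + 1] values of [f]. *)
Lemma finite_index_collision (I : eqType) (R : word I -> word I -> Prop)
    (P : word I -> Prop) (ts : seq (word I)) (f : nat -> word I) :
  (forall w, exists2 t, t \in ts & exists2 h, P h & weq R w (t ++ h)) ->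
  exists a b t h h', [/\ a < b, t \in ts, P h, P h'
    & weq R (f a) (t ++ h) /\ weq R (f b) (t ++ h')].
Proof.
move=> hts.
have /choice[r rP] n : exists t, t \in ts /\ exists2 h, P h & weq R (f n) (t ++ h).
  by have [t tt ht] := hts (f n); exists t.
pose s := [seq r n | n <- iota 0 (size ts).+1].
have : ~~ uniq s.
  apply/negP => us; have := @uniq_leq_size _ s ts us.
  rewrite size_map size_iota ltnn => H; apply/notF/H => _ /mapP[n _ ->].
  by have [] := rP n.
move=> /(uniqPn [::])[a [b [ab]]]; rewrite size_map size_iota => bs.
rewrite !(nth_map 0) ?size_iota ?nth_iota ?(ltn_trans ab) // !add0n => E.
have [at_ [h Ph Eh]] := rP a; have [_ [h' Ph' Eh']] := rP b.
by exists a, b, (r a), h, h'; split=> //; rewrite {2}E.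
Qed.

Lemma coset_quotient (I : eqType) (R : word I -> word I -> Prop)
    (P : word I -> Prop) (t u v h h' : word I) :
  extends_cancel R -> weq R u (t ++ h) -> weq R v (t ++ h') ->
  weq R (winv u ++ v) (winv h ++ h').
Proof.
move=> hR Eu Ev; apply: (weq_cancel_l (x := u)) => //.
rewrite catA weq_catV // cat0s Ev Eu -catA (catA h) weq_catV //; exact: rst_refl.
Qed.

(* The Folner sets are the traces of the orbit on initial segments of the ray [e];
   an element of the subgroup acts there as a bounded shift. *)
Lemma good_action_ray (I : eqType) (R : word I -> word I -> Prop)
    (P : word I -> Prop) (X Y : countType) (rho : word I -> Y -> Y)
    (y0 : Y) (e : nat -> Y) (p : nat) :
  extends_cancel R -> subgroup (weq R) P ->
  (forall y, rho [::] y = y) ->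
  (forall u v y, rho (u ++ v) y = rho u (rho v y)) ->
  (forall u v, weq R u v -> rho u =1 rho v) ->
  (forall u, P u -> (forall h, P h -> rho u (rho h y0) = rho h y0) ->
     weq R u [::]) ->
  injective e -> 0 < p -> (forall k, exists2 h, P h & rho h y0 = e (k * p)) ->
  (forall w, exists (L : nat) (sh : int), (`|sh| <= L%:Z)%R /\
     forall z : nat, L <= z -> rho w (e z) = e `|(z%:Z + sh)%R|%N) ->
  (forall s : seq X, exists x, x \notin s) ->
  good_action (weq R) P X.
Proof.
move=> hR [PR P1 PM PV] rho1 rhoM rhoR faith e_inj p0 ep eray Xinf.
have rhoV u : cancel (rho u) (rho (winv u)).
  by move=> y; rewrite -rhoM (rhoR _ _ (weq_Vcat u hR)) rho1.
pose inorb y := `[< exists2 h, P h & rho h y0 = y >].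
have inorbM u y : P u -> inorb y -> inorb (rho u y).
  move=> Pu /asboolP[h Ph <-]; apply/asboolP; exists (u ++ h); first exact: PM.
  exact: rhoM.
pose orb := {y : Y | inorb y}.
have in0 : inorb y0 by apply/asboolP; exists [::].
pose o0 : orb := exist _ y0 in0.
(* The default [o0] is returned off the orbit; [o z] matters only when [e z] lies in the orbit. *)
pose o z : orb := insubd o0 (e z).
have oval z : inorb (e z) -> val (o z) = e z by move=> ?; rewrite val_insubd ifT.
have inep k : inorb (e (k * p)) by apply/asboolP; exact: ep.
have orb_inf (s : seq orb) : exists x, x \notin s.
  pose s' := [seq o (k * p) | k <- iota 0 (size s).+1].
  have : ~~ all [in s] s'.
    apply/negP => /allP s's; have us' : uniq s'.
      rewrite map_inj_uniq ?iota_uniq // => a b /(congr1 val).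
      by rewrite !oval // => /e_inj/eqP; rewrite eqn_pmul2r // => /eqP.
    by have := uniq_leq_size us' s's; rewrite size_map size_iota ltnn.
  by rewrite -has_predC => /hasP[x _ xs]; exists x.
have [f [g [fK gK]]] := infinite_countType_bij orb_inf Xinf.
(* The action on the orbit carried over to [X]; the default can occur only for words outside [P]. *)
pose rho' u x := f (insubd o0 (rho u (val (g x)))).
have rhoE u y : P u -> inorb y ->
    rho' u (f (insubd o0 y)) = f (insubd o0 (rho u y)).
  by move=> Pu yy; rewrite /rho' fK val_insubd yy.
have rhoE' u x : P u -> val (g (rho' u x)) = rho u (val (g x)).
  by move=> Pu; rewrite /rho' fK val_insubd inorbM //; exact: valP.
have gval_inj : injective (fun x => val (g x)).
  by move=> x y /val_inj/(can_inj gK).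
exists rho'; split.
- split.
  + by move=> x; apply: gval_inj => /=; rewrite rhoE' // rho1.
  + move=> u v Pu Pv x; apply: gval_inj => /=.
    by rewrite !rhoE' // ?rhoM //; exact: PM.
  + move=> u v Pu uv x; apply: gval_inj => /=.
    by rewrite !rhoE' ?(rhoR _ _ uv) //; exact: PR Pu.
- move=> x y.
  have /asboolP[h Ph hx] := valP (g x); have /asboolP[k Pk ky] := valP (g y).
  exists (k ++ winv h); first by apply: PM => //; exact: PV.
  apply: gval_inj => /=; rewrite rhoE'; last by apply: PM => //; exact: PV.
  by rewrite -hx -ky rhoM rhoV.
- move=> u Pu ux; apply: faith => // h Ph.
  have hh : inorb (rho h y0) by apply/asboolP; exists h.
  have := ux (f (insubd o0 (rho h y0))); rewrite rhoE //.
  move=> /(can_inj fK)/(congr1 val); rewrite !val_insubd hh.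
  by rewrite inorbM.
(* The right end k * p is included, so the orbit meets the interval at least in the k + 1 multiples
   of [p]. *)
pose Z k := [seq z <- iota 0 (k * p).+1 | inorb (e z)].
pose S k := [seq f (o z) | z <- Z k].
pose F k := [fset x in S k]%fset.
have card_F k : k < #|` F k|.
  have US : uniq (S k).
    rewrite map_inj_in_uniq ?filter_uniq ?iota_uniq // => a b.
    rewrite !mem_filter => /andP[ha _] /andP[hb _] /(can_inj fK)/(congr1 val).
    by rewrite !oval // => /e_inj.
  rewrite card_fseq undup_id // size_map.
  have us : uniq [seq a * p | a <- iota 0 k.+1].
    rewrite map_inj_uniq ?iota_uniq // => a b /eqP.
    by rewrite eqn_pmul2r // => /eqP.
  have := @uniq_leq_size _ _ (Z k) us; rewrite size_map size_iota; apply.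
  move=> _ /mapP[a + ->]; rewrite mem_iota add0n => /andP[_ ak].
  by rewrite mem_filter inep mem_iota /= add0n ltnS leq_pmul2r.
exists F; split.
  by move=> k; rewrite -cardfs_gt0; apply: leq_ltn_trans (card_F k).
move=> u Pu N N0; have [L [sh [shL ush]]] := eray u.
(* The symmetric difference has at most 4 * L points, while [F k] has more than k. *)
exists (N * (4 * L)) => k kL.
apply: leq_ltn_trans (leq_trans _ kL) (card_F k); rewrite leq_pmul2l //.
set G := [fset rho' u x | x in F k]%fset.
have cardG : #|` G| = #|` F k|.
  rewrite card_imfset //= => x y /(congr1 (fun x => val (g x))) /=.
  rewrite !rhoE' // => /(can_inj (rhoV u)).
  exact: gval_inj.
have GF : #|` (G `\` F k)%fset| <= 2 * L.
  (* A shift by at most [L] pushes out only points among the first or last [L] of the interval. *)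
  pose D := iota 0 L ++ iota ((k * p).+1 - L) L.
  apply: (@leq_trans (size [seq rho' u (f (o z)) | z <- D])); last first.
    by rewrite size_map size_cat !size_iota addnn mul2n.
  apply: leq_trans (size_undup _); rewrite -card_fseq.
  apply: fsubset_leq_card; apply/fsubsetP => x.
  rewrite finmap.inE => /andP[xF /imfsetP[_ /= /[!finmap.inE] /mapP[z + ->] xE]].
  rewrite mem_filter mem_iota add0n => /andP[ze /andP[_ zk]].
  apply/mapP; exists z => //; rewrite mem_cat !mem_iota add0n /=.
  case: (ltnP z L) => //= zL; apply/andP; split; last by lia.
  rewrite leqNgt; apply/negP => zkL; move: xF; rewrite xE rhoE // ush //.
  have e' := inorbM _ _ Pu ze; rewrite ush // in e'.
  move/negP; apply; rewrite finmap.inE; apply/mapP; exists `|(z%:Z + sh)%R|%N => //.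
  rewrite mem_filter e' mem_iota add0n /=; lia.
have -> : 4 * L = 2 * L + 2 * L by lia.
apply: leq_trans (_ : #|` (F k `\` G)%fset| + #|` (G `\` F k)%fset| <= _).
  by rewrite cardfsU leq_subr.
(* [F k] and its image have equal cardinality, so the two differences do as well. *)
apply: leq_add (GF); apply: leq_trans GF.
by rewrite !cardfsD fsetIC cardG.
Qed.

(** * Finite index subgroups of the amalgam *)

Lemma wexp_nseq (I : Type) (l : I * bool) p k : wexp (nseq p l) k = nseq (k * p) l.
Proof. by elim: k => // k IH; rewrite wexpS IH -nseqD mulSn. Qed.

Lemma subgroup_wexp (I : Type) (E : word I -> word I -> Prop) (P : word I -> Prop)
    (w : word I) k : subgroup E P -> P w -> P (wexp w k).
Proof. by move=> [_ P1 PM _] Pw; elim: k => // k IH; exact: PM. Qed.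

Lemma finite_index_good_action (A B X : countType) (c : word A) (d : word B)
    (i : A) (j : B) (H : word (A + B) -> Prop) :
  cyc_reduced c -> cyc_reduced d -> c <> [::] -> d <> [::] ->
  expsum i c = 0%R -> expsum j d = 0%R ->
  subgroup (amalg_eq c d) H -> finite_index (amalg_eq c d) H ->
  (forall s : seq X, exists x : X, x \notin s) ->
  good_action (amalg_eq c d) H X.
Proof.
move=> rc rd c0 d0 ec ed sH [ts hts] Xinf.
have hR := @amalg_extends_cancel A B c d.
have [HR H1 HM HV] := sH.
pose T n : word (A + B) := nseq n (inl i, false).
have TE n : T n = emb_l (nseq n (i, false)) by rewrite /emb_l map_nseq.
have TD a b : T (a + b) = T a ++ T b by exact: nseqD.
have quotH t u v h h' : H h -> H h' ->
    amalg_eq c d u (t ++ h) -> amalg_eq c d v (t ++ h') -> H (winv u ++ v).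
  move=> Hh Hh' Eu Ev; apply: (HR (winv h ++ h')); last by apply: HM => //; exact: HV.
  by apply: rst_sym; exact: coset_quotient Eu Ev.
(* Two powers of the generator [i] lie in the same coset of [H]; their quotient is in [H]. *)
have [p p0 Hp] : exists2 p, 0 < p & H (T p).
  have [a [b [t [h [h' [ab _ Hh Hh' [Ea Eb]]]]]]] := finite_index_collision T hts.
  exists (b - a); first by rewrite subn_gt0.
  apply: HR (quotH _ _ _ _ _ Hh Hh' Ea Eb).
  rewrite -{1}(subnKC (ltnW ab)) TD catA; apply: (@weq_cat _ _ _ [::]).
    exact: weq_Vcat.
  exact: rst_refl.
apply: (@good_action_ray (A + B)%type (amalg_rel c d) H X (amalg_point c d)
  (@amalg_act A B c d i j) (inl 0%R) (fun z => inl (Posz z)) p) => //.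
- exact: amalg_act_cat.
- exact: amalg_act_weq ec ed.
- move=> u Hu fixu.
  (* [M] is the threshold of [power_conj_cyclic]. The exponents [K r] differ by multiples of [M] and
     exceed [size u] plus the length of any representative in [ts]. *)
  pose M := (2 * size c).+1.
  pose K r := (size u + (\max_(t <- ts) size t) + r).+1 * M.
  have [a [b [t [h [h' [ab tts Hh Hh' [Ea Eb]]]]]]] :=
    finite_index_collision (fun r => T (K r) ++ [:: (inr j, true)]) hts.
  have tmax : size t <= \max_(t <- ts) size t by exact: leq_bigmax_seq.
  have Kbig r : size u + size t < K r.
    by rewrite /K; move: (\max_(_ <- _) _) tmax => m tm; nia.
  have hT r : expsum (inl i) (T (K r)) = Posz (K r) by exact: expsum_nseq.
  have far w r : size w <= size u + size t ->
      amalg_act i j w (inr (coset_of c d (T (K r)))) =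
        inr (coset_of c d (w ++ T (K r))).
    by move=> wr; rewrite amalg_act_far // hT ltz_nat; exact: leq_ltn_trans wr (Kbig r).
  (* [k] sends 0 to the coset of [winv t ++ T (K r)], a point of the orbit and so fixed by [u]; it
     is far enough out for both words to act by left multiplication. *)
  have fixed r k : H k -> amalg_eq c d (T (K r) ++ [:: (inr j, true)]) (t ++ k) ->
      exists q, amalg_eq c d ((u ++ winv t) ++ T (K r))
                             ((winv t ++ T (K r)) ++ wpow (emb_l c) q).
    move=> Hk E.
    have {}E : amalg_eq c d k (winv t ++ (T (K r) ++ [:: (inr j, true)])).
      apply: (weq_cancel_l (x := t)) => //; rewrite catA.
      apply: rst_trans (rst_sym _ _ _ _ E) _.
      apply: (@weq_cat _ _ [::] _ _ _ _ (rst_refl _ _ _)).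
      by apply: rst_sym; exact: weq_catV.
    have := fixu k Hk; rewrite (amalg_act_weq ec ed E) amalg_act_cat amalg_act_enter.
    rewrite -amalg_act_cat !far; last by rewrite size_cat size_winv.
      by move=> cosets; apply: coset_of_inj; exact: inr_inj cosets.
    by rewrite size_winv leq_addl.
  have [q Eq] := fixed _ _ Hh Ea; have [q' Eq'] := fixed _ _ Hh' Eb.
  have KE : K b = K a + (b - a) * M by rewrite /K -mulnDl; congr (_ * M); lia.
  (* Substituting the identity for [a] into that for [b] and cancelling gives c^q T((b - a) M) =
     T((b - a) M) c^q'. *)
  have q'0 : q' = 0%R.
    apply: (@power_conj_cyclic A B c d i q q' ((b - a) * M)) => //.
      by apply: leq_pmull; rewrite subn_gt0.
    have embD x y : @emb_l A B (x ++ y) = emb_l x ++ emb_l y by exact: map_cat.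
    rewrite !embD -!wpow_emb_l -TE.
    apply: (weq_cancel_l (x := winv t ++ T (K a))) => //.
    have -> : (winv t ++ T (K a)) ++ (T ((b - a) * M) ++ wpow (emb_l c) q') =
        (winv t ++ T (K b)) ++ wpow (emb_l c) q' by rewrite KE TD !catA.
    apply: rst_trans Eq'; rewrite catA.
    have -> : (u ++ winv t) ++ T (K b) =
        ((u ++ winv t) ++ T (K a)) ++ T ((b - a) * M) by rewrite KE TD !catA.
    by apply: weq_cat (rst_refl _ _ _); exact: rst_sym.
  move: Eq'; rewrite q'0 cats0 => /(weq_cancel_r hR) Eu.
  exact: (weq_cancel_r (x := winv t) (v := [::]) hR Eu).
- by move=> x y [].
- move=> k; exists (T (k * p)).
    by rewrite /T -wexp_nseq; exact: subgroup_wexp sH Hp.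
  exact: amalg_act_power.
- move=> w; have [k kw kP] := @amalg_act_ray A B c d i j w.
  exists (size w), k; split=> // z zw; rewrite kP ?lez_nat //.
  have : (0 <= Posz z + k)%R by move: (size w) kw zw => n; lia.
  by move=> /gez0_abs ->.
Qed.

Theorem theorem14 (n m : nat) (hn : (1 <= n)%N) (hm : (1 <= m)%N)
  (X : countType) (Xinf : forall s : seq X, exists x : X, x \notin s)
  (c : word 'I_n.+1) (d : word 'I_m.+1)
  (hc : cyc_reduced c) (hd : cyc_reduced d)
  (hcp : ~ primitive c) (hdp : ~ primitive d)
  (hce : exists i, occurs i c /\ expsum i c = 0%R)
  (hde : exists j, occurs j d /\ expsum j d = 0%R) :
  good_action (amalg_eq c d) (fun _ => True) X /\
  (forall H : word ('I_n.+1 + 'I_m.+1) -> Prop,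
     subgroup (amalg_eq c d) H -> finite_index (amalg_eq c d) H ->
     good_action (amalg_eq c d) H X).
Proof.
have [[i [ic ei]] [j [jd ej]]] := (hce, hde).
have c0 : c <> [::] by move=> c0; rewrite c0 in ic.
have d0 : d <> [::] by move=> d0; rewrite d0 in jd.
have main H : subgroup (amalg_eq c d) H -> finite_index (amalg_eq c d) H ->
    good_action (amalg_eq c d) H X.
  by move=> sH iH; exact: (finite_index_good_action hc hd c0 d0 ei ej sH iH Xinf).
split=> //; apply: main => //.
(* The whole group has index one, with the empty word as sole representative. *)
exists [:: [::]] => w; exists [::]; first by rewrite mem_head.
by exists w => //; exact: rst_refl.
Qed.
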